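(* For $\alpha_1,\alpha_2\in[0,1]$, let $C^{\mathrm{MO}}_{\alpha_1,\alpha_2}(u,v)=\min\left(u^{1-\alpha_1}v,\;uv^{1-\alpha_2}\right)$, $(u,v)\in[0,1]^2$, be the Marshall-Olkin copula. Then, for all $\alpha_1,\alpha_2\in[0,1]$, Chatterjee's rank correlation of $C^{\mathrm{MO}}_{\alpha_1,\alpha_2}$ is $$\xi\left(C^{\mathrm{MO}}_{\alpha_1,\alpha_2}\right)=\frac{2\alpha_1^2\alpha_2}{3\alpha_1+\alpha_2-2\alpha_1\alpha_2}.$$ Furthermore, letting $\alpha_1=\alpha_2=\delta$, one obtains as a special case that, for $\delta\in[0,1]$, the Cuadras-Augé copula $C^{\mathrm{CA}}_\delta(u,v)=\min\{u,v\}^{\delta}(uv)^{1-\delta}$ satisfies $$\xi\left(C^{\mathrm{CA}}_\delta\right)=\frac{\delta^2}{2-\delta}.$$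
   Context: For a bivariate copula $C$, Chatterjee's rank correlation is $\xi(C)=6\int_0^1\int_0^1(\partial_1C(u,v))^2\,du\,dv-2$, where $\partial_1C$ is the (almost everywhere defined) partial derivative of $C$ with respect to its first argument. *)

(* Defs.v *)
(* Written over MathComp and MathComp-Analysis. *)
From HB Require Import structures.
From mathcomp Require Import all_boot all_order all_algebra.
From mathcomp Require Import all_classical all_reals all_analysis.

Set Implicit Arguments.
Unset Strict Implicit.
Unset Printing Implicit Defensive.

Import Order.TTheory GRing.Theory Num.Theory.
Import numFieldNormedType.Exports.

Local Open Scope classical_set_scope.
Local Open Scope ring_scope.

(* A bivariate copula is represented by any total function R -> R -> R that
   extends it from [0,1]^2: for 0 < u < 1 and 0 <= v <= 1 the two-sided
   derivative below only involves values of C on [0,1]^2. *)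
Definition partial1 (R : realType) (C : R -> R -> R) (u v : R) : R :=
  derive1 (fun t : R => C t v) u.

(* Iterated Lebesgue integral, inner variable u.  The value of partial1 at a
   point where the derivative does not exist is a default value of R; for a
   copula these points form a null set for each fixed v.  The result lives in
   \bar R, so stating that it equals r%:E includes the finiteness of the
   integral. *)
Definition chatterjee_xi (R : realType) (C : R -> R -> R) : \bar R :=
  (6%:E * (\int[lebesgue_measure]_(v in `[0%R, 1%R])
             \int[lebesgue_measure]_(u in `[0%R, 1%R])
               ((partial1 C u v) ^+ 2)%:E)
   - 2%:E)%E.

(* powR satisfies 0 `^ 0 = 1 and 0 `^ x = 0 for x != 0, so both copulas below
   vanish when u = 0 or v = 0, for all parameters in [0,1]. *)
Definition marshall_olkin (R : realType) (a1 a2 : R) (u v : R) : R :=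
  Num.min (u `^ (1 - a1) * v) (u * v `^ (1 - a2)).

Definition cuadras_auge (R : realType) (d : R) (u v : R) : R :=
  (Num.min u v) `^ d * (u * v) `^ (1 - d).

(* Main.v *)
(* In the nondegenerate case, on the open unit square and off the curve
   u^(a1/a2) = v, the partial derivative is v^(1-a2) where u^(a1/a2) < v and
   (1-a1) u^(-a1) v where u^(a1/a2) > v.  Integrating the square in u first
   would bring in a logarithm at a1 = 1/2; after Tonelli the inner integral in
   v is a constant plus a multiple of u^p with p = a1 (3/a2 - 2) >= 0, so all
   parameters are treated uniformly. *)
Require Import Defs.
From HB Require Import structures.
From mathcomp Require Import all_boot all_order all_algebra.
From mathcomp Require Import all_classical all_reals all_analysis.
From mathcomp Require Import measurable_realfun ring lra.

Import Order.TTheory GRing.Theory Num.Theory.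
Import numFieldNormedType.Exports.

Local Open Scope classical_set_scope.
Local Open Scope ring_scope.

(** * Real powers and the integral of [c + d * t^p] *)

Lemma continuous_powR {R : realType} (p x : R) : 0 < x ->
  {for x, continuous (fun t : R => t `^ p)}.
Proof.
move=> x0; apply: differentiable_continuous; apply/derivable1_diffP.
by apply: derivable_powR; rewrite in_itv/= andbT.
Qed.

Lemma powR_cvg_right {R : realType} (p x : R) : 0 <= p -> 0 <= x ->
  (t `^ p @[t --> x^'+] --> x `^ p)%classic.
Proof.
(* For p = 0 the function is constantly 1, even at x = 0, since 0 to the power 0 is 1. *)
rewrite le_eqVlt => /predU1P[<- _|p0].
  by under eq_fun do rewrite powRr0; rewrite powRr0; exact: cvg_cst.
rewrite le_eqVlt => /predU1P[<-|x0].
  by rewrite powR0 ?gt_eqF//; exact: powR_cvg0.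
by apply: cvg_at_right_filter; exact: continuous_powR.
Qed.

(** The fundamental theorem of calculus asks for a derivative only inside the interval and for
    one-sided continuity at its ends. This admits x = 0, where powers with exponent p >= 0 are
    right-continuous. *)
Lemma integral_affine_powR {R : realType} (c d p x y : R) :
  0 <= p -> 0 <= x -> x < y ->
  (\int[lebesgue_measure]_(t in `[x, y]) (c + d * t `^ p)%:E)%E =
  (c * (y - x) + d * ((y `^ (p + 1) - x `^ (p + 1)) / (p + 1)))%:E.
Proof.
move=> p0 x0 xy; have p1 : 0 < p + 1 by rewrite ltr_wpDl.
pose F (t : R) : R := c * t + d / (p + 1) * t `^ (p + 1).
have dF (t : R) : 0 < t -> is_derive t (1 : R) F (c + d * t `^ p).
  move=> t0; have D := is_derive1_powR (p + 1) t0.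
  rewrite /F; apply: is_derive_eq.
  rewrite addrK /GRing.scale/= mulr1.
  by congr (_ + _); field; rewrite gt_eqF.
have pos (t : R) : t \in `]x, y[%R -> 0 < t.
  by rewrite in_itv/= => /andP[xt _]; exact: le_lt_trans xt.
rewrite (@continuous_FTC2 _ (fun t => c + d * t `^ p) F)//.
- rewrite -EFinB /F; congr EFin; field; by rewrite gt_eqF.
- apply/continuous_within_itvP => //; split.
  + move=> t /pos t0; apply: cvgD; first exact: cvg_cst.
    by apply: cvgM; [exact: cvg_cst|exact: continuous_powR].
  + apply: cvgD; first exact: cvg_cst.
    by apply: cvgM; [exact: cvg_cst|exact: powR_cvg_right].
  + apply: cvg_at_left_filter; apply: cvgD; first exact: cvg_cst.
    apply: cvgM; [exact: cvg_cst|apply: continuous_powR].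
    exact: le_lt_trans xy.
- split.
  + by move=> t /pos/dF[].
  + apply: cvgD; apply: cvgM; try exact: cvg_cst.
      by apply: cvg_at_right_filter; exact: cvg_id.
    by apply: powR_cvg_right => //; exact: ltW.
  + apply: cvg_at_left_filter; apply: cvgD; apply: cvgM; try exact: cvg_cst.
      exact: cvg_id.
    by apply: continuous_powR; exact: le_lt_trans xy.
- by move=> t /pos/dF Ft; rewrite derive1E derive_val.
Qed.

(** * Null sets and the order of integration *)

(** Measurability of [f] is derived, not assumed: [f] inherits it from [g] on the interval without
    [s], and any function is measurable on a singleton. This suits [partial1], whose value at a kink
    is arbitrary. *)
Lemma eq_integral_itv_setD1 {R : realType} (f g : R -> \bar R) (x y s : R) :
  measurable_fun setT g ->
  (forall t, x < t < y -> t != s -> f t = g t) ->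
  (\int[lebesgue_measure]_(t in `[x, y]) f t =
   \int[lebesgue_measure]_(t in `[x, y]) g t)%E.
Proof.
move=> mg fg.
have mg' A : measurable_fun A g by apply: measurable_funS mg.
have mD : measurable (`]x, y[%classic `\ s : set R) by apply: measurableD.
have eqD t : t \in (`]x, y[%classic `\ s : set R) -> f t = g t.
  by rewrite inE/= in_itv/= => -[ty /eqP ts]; exact: fg.
have mfD : measurable_fun (`]x, y[%classic `\ s : set R) f.
  by apply: (eq_measurable_fun g) => // t tD; rewrite eqD.
have mf : measurable_fun (`]x, y[%classic : set R) f.
  have [sD|sD] := pselect ((`]x, y[%classic : set R) s).
    rewrite -[X in measurable_fun X _](setD1K sD).
    by apply/measurable_funU => //; split => //; exact: measurable_fun_set1.
  by rewrite not_setD1 in mfD.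
rewrite !integral_itv_bndoo// -(@integral_setD1 _ f s)//.
by rewrite -(@integral_setD1 _ g s)//; apply: eq_integral.
Qed.

(** Extending [f] by zero outside the rectangle reduces this to Tonelli on the whole plane. *)
Lemma fubini_tonelli_setX {R : realType} (f : R * R -> \bar R) (D E : set R) :
  measurable D -> measurable E ->
  measurable_fun setT f -> (forall z, 0 <= f z)%E ->
  (\int[lebesgue_measure]_(x in D) \int[lebesgue_measure]_(y in E) f (x, y) =
   \int[lebesgue_measure]_(y in E) \int[lebesgue_measure]_(x in D) f (x, y))%E.
Proof.
move=> mD mE mf f0.
pose h := (f \_ (D `*` E)%classic).
have h0 z : (0 <= h z)%E by rewrite /h/patch; case: ifP.
have mh : measurable_fun setT h.
  apply/(measurable_restrictT _ _).1; first exact: measurableX.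
  exact: measurable_funS mf.
transitivity (\int[lebesgue_measure]_x \int[lebesgue_measure]_y h (x, y))%E.
  rewrite integral_mkcond; apply: eq_integral => x _.
  rewrite /h/patch; case: ifPn => xD.
    by rewrite integral_mkcond; apply: eq_integral => y _; rewrite /patch in_setX/= xD.
  by rewrite integral0_eq// => y _; rewrite in_setX/= (negbTE xD).
rewrite fubini_tonelli//.
rewrite [RHS]integral_mkcond; apply: eq_integral => y _.
rewrite /h/patch; case: ifPn => yE.
  by rewrite [RHS]integral_mkcond; apply: eq_integral => x _;
    rewrite /patch in_setX/= yE andbT.
by rewrite integral0_eq// => x _; rewrite in_setX/= (negbTE yE) andbF.
Qed.

(** Tonelli is applied to the jointly measurable [g], so joint measurability of [partial1 C] never
    has to be shown. At height v, [s v] is the one abscissa in the open interval where the two may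
    differ; [g] takes the pair (v, u). *)
Lemma chatterjee_xi_swap {R : realType} (C : R -> R -> R) (s : R -> R)
    (g : R * R -> R) :
  measurable_fun setT g -> (forall z, 0 <= g z) ->
  (forall u v, 0 < u < 1 -> 0 < v < 1 -> u != s v ->
     partial1 C u v ^+ 2 = g (v, u)) ->
  chatterjee_xi C =
  (6%:E * (\int[lebesgue_measure]_(u in `[0%R, 1%R])
             \int[lebesgue_measure]_(v in `[0%R, 1%R]) (g (v, u))%:E)
   - 2%:E)%E.
Proof.
move=> mg g0 Cg; rewrite /chatterjee_xi; congr (6%:E * _ - 2%:E)%E.
have mg' : measurable_fun setT (EFin \o g) by exact/measurable_EFinP.
rewrite -(@fubini_tonelli_setX _ (EFin \o g))//=.
(* Only the endpoints v = 0 and v = 1 are discarded; the extra point 0 is a dummy. *)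
apply: (@eq_integral_itv_setD1 _ _ _ _ _ 0).
  pose h := ((EFin \o g) \_ (setT `*` `[0%R, 1%R])%classic).
  have mh : measurable_fun setT h.
    apply/(measurable_restrictT _ _).1; first exact: measurableX.
    exact: measurable_funS mg'.
  have h0 z : (0 <= h z)%E by rewrite /h/patch; case: ifP; rewrite //= lee_fin.
  have := @measurable_fun_fubini_tonelli_F _ _ _ _ _ lebesgue_measure h mh h0.
  apply: eq_measurable_fun => v _.
  rewrite [RHS]integral_mkcond; apply: eq_integral => u _.
  by rewrite /h/patch in_setX/= in_setT.
move=> v v01 _; apply: (@eq_integral_itv_setD1 _ _ _ _ _ (s v)).
  by apply/measurable_EFinP; apply: measurableT_comp mg _; exact: pair1_measurable.
by move=> u u01 us; rewrite Cg.
Qed.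

(** * The branches of the copula and their derivatives in u *)

Lemma partial1_near_eq {R : realType} (C : R -> R -> R) (f : R -> R) (u v l : R) :
  (\forall t \near u, C t v = f t) -> is_derive u 1 f l -> partial1 C u v = l.
Proof.
move=> Cf fl; rewrite /partial1 derive1E (@near_eq_derive _ _ _ _ f)//.
exact: derive_val.
Qed.

Lemma near_itv01 {R : realType} (u : R) : 0 < u < 1 ->
  \forall t \near u, 0 < t < 1.
Proof.
move=> /andP[u0 u1]; near=> t; apply/andP; split; near: t.
  exact: lt_nbhsr.
exact: lt_nbhsl.
Unshelve. all: end_near. Qed.

(** The degenerate case is the independence copula, because x <= x^(1-a) for x in (0,1) and a in
    [0,1]. *)
Lemma marshall_olkin_eq_mul {R : realType} (a1 a2 u v : R) :
  0 <= a1 <= 1 -> 0 <= a2 <= 1 -> 0 < u < 1 -> 0 < v < 1 ->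
  (a1 == 0) || (a2 == 0) -> marshall_olkin a1 a2 u v = u * v.
Proof.
move=> /andP[a10 a11] /andP[a20 a21] /andP[u0 u1] /andP[v0 v1].
rewrite /marshall_olkin => /orP[|] /eqP->; rewrite subr0 powRr1 ?ltW//.
  apply: min_l; rewrite ler_pM2l//.
  by apply: ger1_powR; [rewrite v0 ltW|lra].
apply: min_r; rewrite ler_pM2r//.
by apply: ger1_powR; [rewrite u0 ltW|lra].
Qed.

Lemma powR_split {R : realType} (e x : R) : 0 <= x ->
  x = x `^ (1 - e) * x `^ e.
Proof.
by move=> x0; rewrite -powRD ?subrK ?powRr1// oner_eq0.
Qed.

(** With the common factor u^(1-a1) v^(1-a2) taken out, the minimum compares u^a1 with v^a2. Raising
    the hypothesis to the power a2 decides which is smaller. *)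
Lemma marshall_olkin_r {R : realType} (a1 a2 u v : R) :
  0 < a2 -> 0 < u -> 0 < v ->
  u `^ (a1 / a2) <= v -> marshall_olkin a1 a2 u v = u * v `^ (1 - a2).
Proof.
move=> a20 u0 v0 uv; rewrite /marshall_olkin.
apply: min_r; rewrite [leLHS](_ : _ = u `^ (1 - a1) * v `^ (1 - a2) * u `^ a1);
  last by rewrite {1}(@powR_split _ a1 u) ?ltW//; ring.
rewrite [leRHS](_ : _ = u `^ (1 - a1) * v `^ (1 - a2) * v `^ a2);
  last by rewrite {1}(@powR_split _ a2 v) ?ltW//; ring.
rewrite ler_pM2l ?mulr_gt0 ?powR_gt0//.
rewrite (_ : a1 = a1 / a2 * a2); last by rewrite divfK ?gt_eqF.
by rewrite powRrM; apply: ge0_ler_powR; rewrite ?nnegrE ?powR_ge0// ltW.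
Qed.

Lemma marshall_olkin_l {R : realType} (a1 a2 u v : R) :
  0 < a2 -> 0 < u -> 0 < v ->
  v <= u `^ (a1 / a2) -> marshall_olkin a1 a2 u v = u `^ (1 - a1) * v.
Proof.
move=> a20 u0 v0 uv; rewrite /marshall_olkin.
apply: min_l; rewrite [leLHS](_ : _ = u `^ (1 - a1) * v `^ (1 - a2) * v `^ a2);
  last by rewrite {1}(@powR_split _ a2 v) ?ltW//; ring.
rewrite [leRHS](_ : _ = u `^ (1 - a1) * v `^ (1 - a2) * u `^ a1);
  last by rewrite {1}(@powR_split _ a1 u) ?ltW//; ring.
rewrite ler_pM2l ?mulr_gt0 ?powR_gt0//.
rewrite [in leRHS](_ : a1 = a1 / a2 * a2); last by rewrite divfK ?gt_eqF.
by rewrite powRrM; apply: ge0_ler_powR; rewrite ?nnegrE ?powR_ge0// ltW.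
Qed.

(** Here [z] is (v, u). The choice of branch on the curve itself is immaterial, the curve being a
    null set. *)
Definition mo_partial_sq {R : realType} (a1 a2 : R) (z : R * R) : R :=
  if z.2 `^ (a1 / a2) < z.1 then (z.1 `^ (1 - a2)) ^+ 2
  else ((1 - a1) * z.2 `^ (- a1) * z.1) ^+ 2.

Lemma measurable_mo_partial_sq {R : realType} (a1 a2 : R) :
  measurable_fun setT (mo_partial_sq a1 a2).
Proof.
have powM (f : R * R -> R) (p : R) : measurable_fun setT f ->
    measurable_fun setT (fun z => f z `^ p).
  by move=> mf; apply: (measurableT_comp (measurable_powR p) mf).
apply: measurable_fun_ifT.
- by apply: measurable_fun_ltr => //; apply: powM.
- by apply: measurable_funX; apply: powM.
- apply: measurable_funX; apply: measurable_funM => //.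
  by apply: measurable_funM => //; apply: powM.
Qed.

(** Off the curve the inequality between u^(a1/a2) and v is strict, hence persists near u by
    continuity, and [C] coincides there with a single differentiable branch. *)
Lemma partial1_marshall_olkin {R : realType} (C : R -> R -> R) (a1 a2 u v : R) :
  0 < a1 -> 0 < a2 -> 0 < u < 1 -> 0 < v < 1 ->
  (forall t : R, 0 < t < 1 -> C t v = marshall_olkin a1 a2 t v) ->
  u != v `^ (a2 / a1) ->
  partial1 C u v ^+ 2 = mo_partial_sq a1 a2 (v, u).
Proof.
move=> a10 a20 u01 /andP[v0 v1] CE uv; have /andP[u0 u1] := u01.
(* The exceptional point was given solved for u; the branches are separated by the same curve solved
   for v. *)
have uv' : u `^ (a1 / a2) != v.
  apply: contra_neq uv => <-; rewrite -powRrM mulrA divfK ?divff ?powRr1 ?ltW//.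
    by rewrite gt_eqF.
  by rewrite gt_eqF.
have cu := @continuous_powR _ (a1 / a2) u u0.
have n01 := near_itv01 u u01.
rewrite /mo_partial_sq/=; case: ltP => [uv1|uv1]; congr (_ ^+ 2).
  apply: (@partial1_near_eq _ _ (fun t => t * v `^ (1 - a2))).
    have nlt : \forall t \near u, t `^ (a1 / a2) < v by exact: (cvgr_lt _ cu).
    near=> t; have t01 : 0 < t < 1 by near: t.
    rewrite CE// marshall_olkin_r//; first by case/andP: t01.
    by apply: ltW; near: t.
  by apply: is_derive_eq; rewrite /GRing.scale/= ?mulr0 ?add0r mulr1.
move: uv1; rewrite le_eqVlt eq_sym (negbTE uv')/= => uv1.
apply: (@partial1_near_eq _ _ (fun t => t `^ (1 - a1) * v)).
  have nlt : \forall t \near u, v < t `^ (a1 / a2) by exact: (cvgr_gt _ cu).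
  near=> t; have t01 : 0 < t < 1 by near: t.
  rewrite CE// marshall_olkin_l//; first by case/andP: t01.
  by apply: ltW; near: t.
have D := is_derive1_powR (1 - a1) u0.
apply: is_derive_eq; rewrite /GRing.scale/=.
rewrite (_ : 1 - a1 - 1 = - a1); last by ring.
by ring.
Unshelve. all: end_near. Qed.

(** * Evaluation of the two integrals *)

(** The integral is split at t = u^(a1/a2). Both pieces are power integrals in v, and both produce
    the same power of u. *)
Lemma integral_mo_partial_sq_v {R : realType} (a1 a2 u : R) :
  0 < a1 -> 0 < a2 <= 1 -> 0 < u < 1 ->
  (\int[lebesgue_measure]_(v in `[0%R, 1%R]) (mo_partial_sq a1 a2 (v, u))%:E)%E
  = ((3 - 2 * a2)^-1 + ((1 - a1) ^+ 2 / 3 - (3 - 2 * a2)^-1) *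
      u `^ (a1 * (3 / a2 - 2)))%:E.
Proof.
move=> a10 /andP[a20 a21] /andP[u0 u1].
set t := u `^ (a1 / a2).
have t0 : 0 < t by exact: powR_gt0.
have t1 : t < 1.
  have := @gt0_ltr_powR _ (a1 / a2) (divr_gt0 a10 a20) u 1.
  by rewrite powR1; apply=> //; rewrite nnegrE ltW.
have mg A : measurable_fun A (fun v => (mo_partial_sq a1 a2 (v, u))%:E).
  apply/measurable_EFinP; apply: measurable_funS (measurableT) _ _ => //.
  by apply: measurableT_comp (measurable_mo_partial_sq a1 a2) _; exact: pair2_measurable.
rewrite (_ : `[0, 1] = `[0, t] `|` `]t, 1])%classic; last first.
  by rewrite -itv_bndbnd_setU// bnd_simp ltW.
rewrite integral_setU//=; last 2 first.
  exact: mg.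
  by apply/disj_setPLR => v/=; rewrite !in_itv/= => /andP[_ vt] /andP[/lt_geF];
    rewrite vt.
have -> : (\int[lebesgue_measure]_(v in `[0%R, t]) (mo_partial_sq a1 a2 (v, u))%:E)%E
   = (((1 - a1) * u `^ (- a1)) ^+ 2 * (t `^ 3 / 3))%:E.
  have := @integral_affine_powR _ 0 (((1 - a1) * u `^ (- a1)) ^+ 2) 2 0 t.
  rewrite mul0r add0r powR0 ?subr0; last by rewrite gt_eqF.
  rewrite (_ : 2 + 1 = 3 :> R); last by ring.
  move=> <-//; apply: eq_integral => v; rewrite inE/= in_itv/= => /andP[v0 vt].
  by rewrite /mo_partial_sq/= ltNge vt/= powR_mulrn// exprMn add0r.
have -> : (\int[lebesgue_measure]_(v in `]t, 1%R]) (mo_partial_sq a1 a2 (v, u))%:E)%E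
   = ((1 - t `^ (3 - 2 * a2)) / (3 - 2 * a2))%:E.
  have := @integral_affine_powR _ 0 1 (2 - 2 * a2) t 1.
  rewrite mul0r add0r mul1r powR1.
  rewrite (_ : 2 - 2 * a2 + 1 = 3 - 2 * a2); last by ring.
  move=> <-//; [|lra|exact: ltW].
  (* The endpoint t is removed because [mo_partial_sq] uses the other branch there. *)
  rewrite -integral_itv_obnd_cbnd; last first.
    apply/measurable_EFinP; apply: measurable_funS (measurableT) _ _ => //.
    apply: measurable_funD => //; apply: measurable_funM => //.
  apply: eq_integral => v; rewrite inE/= in_itv/= => /andP[vt v1].
  rewrite /mo_partial_sq/= vt -powR_mulrn ?powR_ge0// -powRrM.
  by congr EFin; rewrite add0r mul1r; congr (_ `^ _); ring.
rewrite -EFinD; congr EFin.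
(* The exponents agree: 3 a1/a2 - 2 a1 from the lower piece, (a1/a2)(3 - 2 a2) from the upper
   one. *)
have uE : (u `^ (- a1)) ^+ 2 * t `^ 3 = u `^ (a1 * (3 / a2 - 2)).
  rewrite -powR_mulrn ?powR_ge0// -!powRrM -powRD; last by rewrite (gt_eqF u0) implybT.
  by congr (_ `^ _); ring.
have tE : t `^ (3 - 2 * a2) = u `^ (a1 * (3 / a2 - 2)).
  by rewrite -powRrM; congr (_ `^ _); field; rewrite gt_eqF.
rewrite tE exprMn mulrA -(mulrA ((1 - a1) ^+ 2)) uE; field.
by rewrite gt_eqF//; lra.
Qed.

(** Allowing any [C] that agrees with the copula on the open square lets the result apply to the
    Cuadras-Augé formula as well. *)
Lemma chatterjee_xi_marshall_olkin {R : realType} (C : R -> R -> R) (a1 a2 : R) :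
  0 <= a1 <= 1 -> 0 <= a2 <= 1 ->
  (forall u v, 0 < u < 1 -> 0 < v < 1 -> C u v = marshall_olkin a1 a2 u v) ->
  chatterjee_xi C = ((2 * a1 ^+ 2 * a2) / (3 * a1 + a2 - 2 * a1 * a2))%:E.
Proof.
move=> a101 a201 CE.
have [a12|] := boolP ((a1 == 0) || (a2 == 0)).
  rewrite (@chatterjee_xi_swap _ _ (fun=> 0) (fun z => z.1 ^+ 2)).
  - have iv : (\int[lebesgue_measure]_(v in `[0%R, 1%R]) (v ^+ 2)%:E = (3^-1 : R)%:E)%E.
      have := @integral_affine_powR R 0 1 2 0 1.
      rewrite mul0r add0r mul1r powR1 powR0 ?subr0; last by rewrite gt_eqF.
      rewrite (_ : 2 + 1 = 3 :> R); last by ring.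
      rewrite mul1r => <-//; apply: eq_integral => v.
      by rewrite inE/= in_itv/= => /andP[v0 _]; rewrite powR_mulrn// add0r mul1r.
    rewrite /= (eq_integral (cst (3^-1 : R)%:E))//.
    rewrite integral_cst//= lebesgue_measure_itv/= lte_fin ltr01 oppr0 adde0 mule1.
    rewrite -EFinM -EFinB; congr EFin.
    (* The left side is 6/3 - 2 = 0; on the right the numerator vanishes, which suffices even over a
       zero denominator. *)
    rewrite (_ : 2 * a1 ^+ 2 * a2 = 0); last by case/orP: a12 => /eqP->; ring.
    by rewrite mul0r; field.
  - by apply: measurable_funX.
  - by move=> z; exact: sqr_ge0.
  - move=> u v u01 v01 _; congr (_ ^+ 2).
    apply: (@partial1_near_eq _ _ (fun t => t * v)).
      by near=> t; rewrite CE ?marshall_olkin_eq_mul//; near: t; exact: near_itv01.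
    by apply: is_derive_eq; rewrite /GRing.scale/= ?mulr0 ?add0r mulr1.
rewrite negb_or => /andP[a1N0 a2N0].
case/andP: a101 => a10 a11; case/andP: a201 => a20 a21.
have {a1N0}a10 : 0 < a1 by rewrite lt_neqAle eq_sym a1N0.
have {a2N0}a20 : 0 < a2 by rewrite lt_neqAle eq_sym a2N0.
(* This is a2 (p + 1), with p the exponent of u; it becomes the denominator after integration. *)
have D0 : 0 < 3 * a1 + a2 - 2 * a1 * a2 by nra.
have b0 : 0 < 3 - 2 * a2 by lra.
(* Since a2 <= 1, the factor t^3 absorbs the singularity of u^(-2 a1) at 0. *)
have p0 : 0 <= a1 * (3 / a2 - 2).
  rewrite mulr_ge0 ?ltW// subr_gt0 ltr_pdivlMr//; lra.
rewrite (@chatterjee_xi_swap _ _ (fun v => v `^ (a2 / a1)) (mo_partial_sq a1 a2)).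
- rewrite (@eq_integral_itv_setD1 _ _ (fun u => ((3 - 2 * a2)^-1 +
     ((1 - a1) ^+ 2 / 3 - (3 - 2 * a2)^-1) * u `^ (a1 * (3 / a2 - 2)))%:E) 0 1 0).
  + rewrite integral_affine_powR// powR1 powR0 ?subr0; last by rewrite gt_eqF// ltr_wpDl.
    rewrite -EFinM -EFinB; congr EFin; field.
    by rewrite !gt_eqF.
  + apply/measurable_EFinP; apply: measurable_funD => //.
    exact: measurable_funM.
  + by move=> u u01 _; rewrite integral_mo_partial_sq_v// a20.
- exact: measurable_mo_partial_sq.
- by move=> z; rewrite /mo_partial_sq; case: ifP => _; exact: sqr_ge0.
- move=> u v u01 v01 uv; apply: partial1_marshall_olkin => // t t01.
  exact: CE.
Unshelve. all: end_near. Qed.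

(** Taking out (uv)^(1-d) leaves the minimum of u^d and v^d, which is min(u,v)^d by monotonicity of
    the power. *)
Lemma marshall_olkin_cuadras_auge {R : realType} (d u v : R) :
  0 <= d <= 1 -> 0 <= u -> 0 <= v ->
  marshall_olkin d d u v = cuadras_auge d u v.
Proof.
move=> /andP[d0 d1] u0 v0; rewrite /marshall_olkin /cuadras_auge powRM//.
have E1 : u `^ (1 - d) * v = v `^ d * (u `^ (1 - d) * v `^ (1 - d)).
  by rewrite {1}(@powR_split _ d v)//; ring.
have E2 : u * v `^ (1 - d) = u `^ d * (u `^ (1 - d) * v `^ (1 - d)).
  by rewrite {1}(@powR_split _ d u)//; ring.
have w0 : 0 <= u `^ (1 - d) * v `^ (1 - d) by rewrite mulr_ge0 ?powR_ge0.
rewrite E1 E2; have [uv|/ltW vu] := leP u v.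
  by apply: min_r; rewrite ler_wpM2r// ge0_ler_powR ?nnegrE.
by apply: min_l; rewrite ler_wpM2r// ge0_ler_powR ?nnegrE.
Qed.

(* For a1 = a2 = 0 the right-hand side of the first formula is 0 / 0, which is
   0 in MathComp; this is the value for the independence copula. *)
Theorem mainTheorem6 (R : realType) :
  (forall a1 a2 : R, 0 <= a1 <= 1 -> 0 <= a2 <= 1 ->
     chatterjee_xi (marshall_olkin a1 a2) =
       ((2 * a1 ^+ 2 * a2) / (3 * a1 + a2 - 2 * a1 * a2))%:E)
  /\
  (forall d : R, 0 <= d <= 1 ->
     (forall u v : R, 0 <= u <= 1 -> 0 <= v <= 1 ->
        marshall_olkin d d u v = cuadras_auge d u v)
     /\ chatterjee_xi (cuadras_auge d) = (d ^+ 2 / (2 - d))%:E).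
Proof.
split=> [a1 a2 a101 a201|d d01]; first exact: chatterjee_xi_marshall_olkin.
split=> [u v /andP[u0 _] /andP[v0 _]|]; first exact: marshall_olkin_cuadras_auge.
rewrite (@chatterjee_xi_marshall_olkin _ _ d d)//; last first.
  move=> u v /andP[u0 _] /andP[v0 _].
  by rewrite marshall_olkin_cuadras_auge// ltW.
congr EFin; case/andP: d01 => d0 d1.
(* The denominator specializes to 2 d (2 - d), so cancelling d needs d != 0; at d = 0 both sides are
   0. *)
have [->|dN0] := eqVneq d 0; first by rewrite !expr0n/= mulr0 !mul0r.
have d2 : 0 < 2 - d by lra.
field; rewrite (gt_eqF d2)/=.
rewrite (_ : 3 * d + d - 2 * d * d = 2 * (d * (2 - d))); last by ring.
by rewrite mulf_neq0// mulf_neq0// gt_eqF.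
Qed.
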